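(* Let $E\subset X$ be a set of finite perimeter and write $u:=\chi_E$. Let $\varepsilon>0$ and let $G\subset X$ be an open set with $\mathrm{Cap}_1(G)<\varepsilon$ such that whenever $y_k\to x$ with $y_k,x\in X\setminus G$, we have $\min_{l_2\in\{1,\ldots,n\}}|u^{l_1}(y_k)-u^{l_2}(x)|\to0$ for each $l_1=1,\ldots,n$. Then \[ \partial_{X\setminus G}\,\mathcal I(E)\subset\partial^*E\setminus G, \] and both $\partial_{X\setminus G}\,\mathcal I(E)$ and $\partial^*E\setminus G$ are closed subsets of $X$.
   Context: Standing assumptions: $(X,d,\mu)$ is a complete metric space with a Borel regular outer measure $\mu$ that is doubling (there is $C_d\ge 1$ with $0<\mu(B(x,2r))\le C_d\,\mu(B(x,r))<\infty$ for all $x\in X$, $r>0$) and supports a $(1,1)$-Poincaré inequality: there are $C_P>0$, $\lambda\ge 1$ such that for every ball $B(x,r)$, every locally integrable $u$ on $X$ and every upper gradient $g$ of $u$, $\frac{1}{\mu(B(x,r))}\int_{B(x,r)}|u-u_{B(x,r)}|\,d\mu\le C_P\, r\,\frac{1}{\mu(B(x,\lambda r))}\int_{B(x,\lambda r)}g\,d\mu$, where $u_B=\frac1{\mu(B)}\int_B u\,d\mu$. A curve is a rectifiable continuous map from a compact interval into $X$, parametrized by arc length. A nonnegative Borel function $g$ is an upper gradient of an extended real-valued function $u$ if $|u(x)-u(y)|\le\int_\gamma g\,ds$ for all curves $\gamma$ with end points $x,y$ (with $|u(x)-u(y)|=\infty$ if at least one of the values is infinite). For $u\in L^1_{\mathrm{loc}}(X)$,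 $\|Du\|(X):=\inf\{\liminf_{i}\int_X g_{u_i}\,d\mu: u_i\in \mathrm{Lip}_{\mathrm{loc}}(X),\ u_i\to u \text{ in } L^1_{\mathrm{loc}}(X)\}$, each $g_{u_i}$ being an upper gradient of $u_i$. A measurable $E\subset X$ is of finite perimeter if $\|D\chi_E\|(X)<\infty$. Capacity: $\|u\|_{N^{1,1}(X)}:=\|u\|_{L^1(X)}+\inf_g\|g\|_{L^1(X)}$, inf over upper gradients $g$ of $u$; $\mathrm{Cap}_1(A):=\inf\|u\|_{N^{1,1}(X)}$ over $u\in N^{1,1}(X)$ (functions with finite norm) with $u\ge 1$ in a neighborhood of $A$. Codimension $1$ Hausdorff measure: $\mathcal H_R(A):=\inf\{\sum_i \mu(B(x_i,r_i))/r_i: A\subset\bigcup_i B(x_i,r_i),\ r_i\le R\}$, $\mathcal H(A):=\lim_{R\to0^+}\mathcal H_R(A)$. Measure theoretic interior and boundary: $\mathcal I(E):=\{x\in X:\lim_{r\to0^+}\mu(B(x,r)\cap E)/\mu(B(x,r))=1\}$; $\partial^*E$ is the set of points at which both $E$ and $X\setminus E$ have positive upper density. For $A,F\subset X$, $\partial_AF$ denotes the boundary of $F\cap A$ in the subspace topology of $A$. The number $\gamma\in(0,1/2]$ is a fixed constant, depending only on $C_d,C_P,\lambda$, such that for every $E\subset X$ of finite perimeter and $\mathcal H$-a.e. $x\in\partial^*E$, $\gamma\le\liminf_{r\to0^+}\frac{\mu(E\cap B(x,r))}{\mu(B(x,r))}\le\limsup_{r\to0^+}\frac{\mu(E\cap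 B(x,r))}{\mu(B(x,r))}\le1-\gamma$ (such $\gamma$ is known to exist). Put $n:=\lfloor 1/\gamma\rfloor$. Approximate limits and jump values: $u^\wedge(x):=\sup\{t\in\overline{\mathbb R}:\lim_{r\to0^+}\frac{\mu(B(x,r)\cap\{u<t\})}{\mu(B(x,r))}=0\}$, $u^\vee(x):=\inf\{t\in\overline{\mathbb R}:\lim_{r\to0^+}\frac{\mu(B(x,r)\cap\{u>t\})}{\mu(B(x,r))}=0\}$; $u^1:=u^\wedge$, $u^n:=u^\vee$, and inductively for $l=2,\ldots,n-1$, $u^l(x):=\sup\{t\in\overline{\mathbb R}:\lim_{r\to0^+}\frac{\mu(B(x,r)\cap\{u^{l-1}(x)+\delta<u<t\})}{\mu(B(x,r))}=0\ \ \forall\,\delta>0\}$ if $u^{l-1}(x)<u^\vee(x)$, and $u^l(x):=u^\vee(x)$ otherwise. *)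

(* Defs.v *)
From HB Require Import structures.
From mathcomp Require Import all_boot all_order all_algebra.
From mathcomp Require Import all_classical all_reals all_analysis.
From mathcomp Require Import measurable_realfun.

Set Implicit Arguments.
Unset Strict Implicit.
Unset Printing Implicit Defensive.
Import Order.TTheory GRing.Theory Num.Theory.
Import numFieldNormedType.Exports.
Local Open Scope classical_set_scope.
Local Open Scope ring_scope.
Local Open Scope ereal_scope.

#[short(type="completeMetricType")]
HB.structure Definition CompleteMetric (R : numDomainType) :=
  {T of Metric R T & Complete T}.

Section curves.
Context {R : realType} {X : metricType R}.

Definition curve_length (c : R -> X) (a b : R) : \bar R :=
  ereal_sup [set (let F := c \o nth b (a :: s) in
                  (\sum_(0 <= i < size s) mdist (F i) (F i.+1))%:E)
            | s in itv_partition a b].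

(* A rectifiable curve [c], defined on [0, l] and parametrized by arc length.
   The interval is non-degenerate: a constant curve would force every function
   with an upper gradient to be finite everywhere. *)
Definition arc_length_curve (l : R) (c : R -> X) : Prop :=
  [/\ (0 < l)%R, {within `[0%R, l], continuous c} &
      forall s t : R, (0 <= s)%R -> (s <= t)%R -> (t <= l)%R ->
        curve_length c s t = (t - s)%:E].

End curves.

Section metric_measure.
Context {R : realType} {X : completeMetricType R}.

Definition borel_set : set (set X) := <<s @open X >>.

Definition borel_fun (g : X -> \bar R) : Prop :=
  measurable_fun setT (g : g_sigma_algebraType (@open X) -> \bar R).

(* In [\bar R], [+oo - +oo = -oo], so that [`|u x - u y|] is [+oo] as soon as
   one of the two values is infinite. *)
Definition upper_gradient (u g : X -> \bar R) : Prop :=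
  [/\ forall x, 0 <= g x, borel_fun g &
      forall (l : R) (c : R -> X), arc_length_curve l c ->
        `|u (c 0%R) - u (c l)| <=
          \int[@lebesgue_measure R]_(t in `[0%R, l]) g (c t)].

Definition locally_lipschitz (v : X -> R) : Prop :=
  forall x, exists r : R, (0 < r)%R /\ exists k : R,
    forall y z, ball x r y -> ball x r z ->
      (`|v y - v z| <= k * mdist y z)%R.

(* The boundary of [F `&` A] in the subspace topology of [A]. *)
Definition relative_boundary (A F : set X) : set X :=
  @closure (subspace A) (F `&` A) `\` @interior (subspace A) (F `&` A).

Variable mu : {outer_measure set X -> \bar R}.

Definition borel_regular : Prop :=
  borel_set `<=` mu.-caratheodory /\
  forall A : set X, exists B, [/\ borel_set B, A `<=` B & mu B = mu A].

Definition doubling (Cd : R) : Prop :=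
  forall (x : X) (r : R), (0 < r)%R ->
    [/\ 0 < mu (ball x (2 * r)%R),
        mu (ball x (2 * r)%R) <= Cd%:E * mu (ball x r) &
        Cd%:E * mu (ball x r) < +oo].

Definition mu_measurable (u : X -> \bar R) : Prop :=
  measurable_fun setT (u : caratheodory_type mu -> \bar R).

(* Integral over the sigma-algebra of [mu]-measurable sets. *)
Definition mu_integral (A : set X) (u : X -> \bar R) : \bar R :=
  @integral _ (caratheodory_type mu) R mu A u.

Definition mean (A : set X) (u : X -> \bar R) : \bar R :=
  mu_integral A u / mu A.

Definition L1_loc (u : X -> \bar R) : Prop :=
  mu_measurable u /\
  forall x, exists r : R, (0 < r)%R /\
    mu_integral (ball x r) (fun y => `|u y|) < +oo.

Definition cvg_L1_loc (v : nat -> X -> \bar R) (u : X -> \bar R) : Prop :=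
  forall x, exists r : R, (0 < r)%R /\
    mu_integral (ball x r) (fun y => `|v i y - u y|) @[i --> \oo] --> 0.

Definition poincare (CP lambda : R) : Prop :=
  forall (x : X) (r : R) (u g : X -> \bar R), (0 < r)%R ->
    L1_loc u -> upper_gradient u g ->
    let B := ball x r in
    mean B (fun y => `|u y - mean B u|) <=
      CP%:E * r%:E * mean (ball x (lambda * r)%R) g.

Definition variation_norm (u : X -> \bar R) : \bar R :=
  ereal_inf [set z | exists (v : nat -> X -> R) (g : nat -> X -> \bar R),
    [/\ forall i, locally_lipschitz (v i),
        cvg_L1_loc (fun i => EFin \o v i) u,
        forall i, upper_gradient (EFin \o v i) (g i) &
        z = limn_einf (fun i => mu_integral setT (g i))]].

Definition charfun (E : set X) : X -> \bar R := EFin \o \1_E.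

Definition finite_perimeter (E : set X) : Prop :=
  mu.-caratheodory E /\ variation_norm (charfun E) < +oo.

Definition N11_norm (u : X -> \bar R) : \bar R :=
  mu_integral setT (fun x => `|u x|) +
  ereal_inf [set mu_integral setT g | g in upper_gradient u].

Definition N11 (u : X -> \bar R) : Prop :=
  mu_measurable u /\ N11_norm u < +oo.

Definition Cap1 (A : set X) : \bar R :=
  ereal_inf [set N11_norm u | u in [set u | N11 u /\
    exists U : set X, [/\ open U, A `<=` U & forall x, U x -> 1 <= u x]]].

(* Coverings are countable, possibly finite: they are indexed by a set [D] of
   natural numbers. *)
Definition hausdorff_content (r0 : R) (A : set X) : \bar R :=
  ereal_inf [set z | exists (D : set nat) (x : nat -> X) (r : nat -> R),
    [/\ forall i, D i -> (0 < r i <= r0)%R,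
        A `<=` \bigcup_(i in D) ball (x i) (r i) &
        z = \esum_(i in D) (mu (ball (x i) (r i)) / (r i)%:E)]].

Definition hausdorff (A : set X) : \bar R :=
  lim (hausdorff_content r0 A @[r0 --> 0^'+]).

Definition hausdorff_ae (A : set X) (P : X -> Prop) : Prop :=
  exists N : set X, hausdorff N = 0 /\ forall x, A x -> ~ N x -> P x.

Definition density_ratio (E : set X) (x : X) (r : R) : \bar R :=
  mu (ball x r `&` E) / mu (ball x r).

Definition lower_density (E : set X) (x : X) : \bar R :=
  limf_einf (density_ratio E x) 0^'+.

Definition upper_density (E : set X) (x : X) : \bar R :=
  limf_esup (density_ratio E x) 0^'+.

Definition has_density (E : set X) (x : X) (a : \bar R) : Prop :=
  density_ratio E x r @[r --> 0^'+] --> a.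

Definition mt_interior (E : set X) : set X := [set x | has_density E x 1].

Definition mt_boundary (E : set X) : set X :=
  [set x | 0 < upper_density E x /\ 0 < upper_density (~` E) x].

Definition perimeter_density_bound (gamma : R) : Prop :=
  forall E : set X, finite_perimeter E ->
    hausdorff_ae (mt_boundary E) (fun x =>
      [/\ gamma%:E <= lower_density E x,
          lower_density E x <= upper_density E x &
          upper_density E x <= (1 - gamma)%:E]).

Definition approx_lower (u : X -> \bar R) (x : X) : \bar R :=
  ereal_sup [set t | has_density [set y | u y < t] x 0].

Definition approx_upper (u : X -> \bar R) (x : X) : \bar R :=
  ereal_inf [set t | has_density [set y | t < u y] x 0].

(* The inductive sequence [u^1, u^2, ...]; the index [0] is a dummy. *)
Fixpoint jump_rec (u : X -> \bar R) (l : nat) (x : X) : \bar R :=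
  match l with
  | l'.+1 =>
    if l' == 0%N then approx_lower u x
    else if jump_rec u l' x < approx_upper u x then
      ereal_sup [set t | forall delta : R, (0 < delta)%R ->
        has_density [set y | jump_rec u l' x + delta%:E < u y < t] x 0]
    else approx_upper u x
  | 0%N => approx_lower u x
  end.

(* [u^l] for [1 <= l <= n], the value for [l = n] being prescribed. *)
Definition jump_value (n : nat) (u : X -> \bar R) (l : nat) (x : X) : \bar R :=
  if l == n then approx_upper u x else jump_rec u l x.

End metric_measure.

(* Main.v *)
Require Import Defs.
From mathcomp Require Import all_boot all_order all_algebra.
From mathcomp Require Import all_classical all_reals all_analysis.
From mathcomp Require Import measurable_realfun.

Set Implicit Arguments.
Unset Strict Implicit.
Unset Printing Implicit Defensive.
Import Order.TTheory GRing.Theory Num.Theory.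
Import numFieldNormedType.Exports.
Local Open Scope classical_set_scope.
Local Open Scope ring_scope.
Local Open Scope ereal_scope.

(** For [u] the characteristic function of [E], [u^1] and [u^n] are the
    characteristic functions of [I(E)] and of the complement of [I(X \ E)].
    At a point of [I(E)] all the jump values equal [1], and at a point of
    [I(X \ E)] they all equal [0]; as jump values at nearby points of [X \ G]
    are close to these, [u^1] is locally [1] on [X \ G] around the former and
    [u^n] is locally [0] around the latter. Hence [I(E)] and [I(X \ E)] are
    relatively open in [X \ G], and the measure theoretic boundary is the
    complement of their union. *)

(** The assumption on jump values speaks of sequences, while relative openness speaks of
    neighbourhoods. If the conclusion failed, each ball of radius [1/(k+1)] would contain a point of
    [A] outside [P], and these points form a sequence converging to [x]. *)
Lemma near_within_sequential (R : realType) (X : metricType R) (A P : set X)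
    (x : X) :
  (forall y : nat -> X, (forall k, A (y k)) -> y @ \oo --> x ->
     \forall k \near \oo, P (y k)) ->
  \forall y \near x, A y -> P y.
Proof.
move=> seqP; apply: contrapT => notP.
have /choice[y yP] (k : nat) :
    exists y, [/\ ball x k.+1%:R^-1%R y, A y & ~ P y].
  apply: contrapT => noy; apply: notP; apply/nbhs_ballP.
  exists k.+1%:R^-1%R => /=; first by rewrite invr_gt0.
  by move=> y xy Ay; apply: contrapT => nPy; apply: noy; exists y.
have yA k : A (y k) by case: (yP k).
have /seqP : y @ \oo --> x.
  apply/cvg_ballP => e e0; near=> k.
  have [+ _ _] := yP k; apply: le_ball; apply: ltW; near: k.
  exact: (near_infty_natSinv_lt (PosNum e0)).
by move=> /(_ yA)[N _ /(_ _ (leqnn N))]; case: (yP N).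
Unshelve. all: by end_near. Qed.

(** The relative interior is the trace on [A] of an open set [V], and the relative closure is the
    trace of the closure in [X]. The relative boundary is thus an intersection of three closed
    sets. *)
Lemma closed_relative_boundary (R : realType) (X : completeMetricType R)
    (A F : set X) :
  closed A -> closed (relative_boundary A F).
Proof.
move=> clA.
have /open_subspaceP[V oV VA] :
  open (@interior (subspace A) (F `&` A) : set (subspace A)).
  exact: open_interior.
rewrite (_ : relative_boundary A F = closure (F `&` A) `&` A `&` ~` V).
  apply: closedI; last exact: open_closedC.
  by apply: closedI clA; exact: closed_closure.
rewrite /relative_boundary closure_subspaceW; last by move=> y [].
apply/seteqP; split=> y [[clFy Ay]] nVy; split=> // Vy; apply: nVy.
- by have [] : (interior (F `&` A : set (subspace A)) `&` A) y by rewrite -VA.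
- by have [] : (V `&` A) y by rewrite VA.
Qed.

Lemma charfun_eqP (R : realType) (X : completeMetricType R) (B C : set X)
    (x y : X) :
  charfun B x = charfun C y :> \bar R <-> (B x <-> C y).
Proof.
rewrite /charfun /= !indicE.
case: (boolP (x \in B)) => [|/negP]; rewrite inE => Bx;
  case: (boolP (y \in C)) => [|/negP]; rewrite inE => Cy; split=> //.
- by move=> /eqP; rewrite onee_eq0.
- by move=> [/(_ Bx)].
- by move=> /eqP; rewrite eq_sym onee_eq0.
- by move=> [_ /(_ Cy)].
Qed.

(** * Vanishing upper limits of nonnegative functions *)

Section limf_esup_zero.
Context {R : realType}.

Lemma limf_esup_gt0P (f : R -> \bar R) (F : set_system R) :
  Filter F -> (forall t, 0 <= f t) ->
  0 < limf_esup f F <-> ~ (f @ F --> 0).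
Proof.
move=> FF f0; split.
- move=> sup0 /fine_cvgP[ffin /cvgr0Pnorm_lt fcvg].
  move: sup0; apply/negP; rewrite -leNgt; apply/lee_addgt0Pr => e e0.
  rewrite add0e limf_esupE; 
  apply: (@le_trans _ _ (ereal_sup (f @` [set t | f t <= e%:E]))).
    (* The upper limit is an infimum of suprema over members of [F]; convergence to [0] makes this
       sublevel set a member. *)
    apply: ereal_inf_lbound; exists [set t | f t <= e%:E] => //.
    near=> t; have ft : f t \is a fin_num by near: t.
    rewrite /= -(fineK ft) lee_fin (le_trans (ler_norm _))// ltW//.
    by near: t; exact: fcvg.
  by apply: ge_ereal_sup => _ [t + <-].
- move=> ncvg; rewrite ltNge; apply/negP => sup0; apply: ncvg.
  have flt e : (0 < e)%R -> \forall t \near F, f t < e%:E.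
    move=> e0; have : limf_esup f F < e%:E by rewrite (le_lt_trans sup0)// lte_fin.
    rewrite limf_esupE => /ereal_inf_lt[_ [V FV <-] Ve].
    apply: filterS FV => t Vt; apply: le_lt_trans Ve.
    by apply: ereal_sup_ubound; exists t.
  apply/fine_cvgP; split.
    near=> t; rewrite ge0_fin_numE//; apply: lt_trans (ltry 1).
    by near: t; exact: flt.
  apply/cvgr0Pnorm_lt => e e0; near=> t.
  rewrite /= ger0_norm ?fine_ge0// -lte_fin fineK.
    by near: t; exact: flt.
  rewrite ge0_fin_numE//; apply: lt_trans (ltry e).
  by near: t; exact: flt.
Unshelve. all: by end_near. Qed.

End limf_esup_zero.

(** * Densities, and approximate limits of a characteristic function *)

Section density.
Context {R : realType} {X : completeMetricType R}.
Variables (mu : {outer_measure set X -> \bar R}) (Cd : R).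
Hypotheses (Cd_ge1 : (1 <= Cd)%R) (mu_doubling : doubling mu Cd).

Lemma ball_measure_gt0 (x : X) (r : R) : (0 < r)%R -> 0 < mu (ball x r).
Proof.
move=> r0; have r20 : (0 < r / 2)%R by rewrite divr_gt0.
by have [+ _ _] := mu_doubling x r20; rewrite mulrC divfK.
Qed.

Lemma ball_measure_fin_num (x : X) (r : R) :
  (0 < r)%R -> mu (ball x r) \is a fin_num.
Proof.
move=> r0; have [_ _] := mu_doubling x r0.
rewrite ge0_fin_numE ?outer_measure_ge0//; apply: le_lt_trans.
by rewrite -{1}[mu _]mul1e lee_wpmul2r ?outer_measure_ge0// lee_fin.
Qed.

Lemma density_ratio_ge0 (A : set X) (x : X) (r : R) :
  0 <= density_ratio mu A x r.
Proof. by rewrite mule_ge0 ?inve_ge0 ?outer_measure_ge0. Qed.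

Lemma upper_density_gt0P (A : set X) (x : X) :
  0 < upper_density mu A x <-> ~ has_density mu A x 0.
Proof. by apply: limf_esup_gt0P => r; exact: density_ratio_ge0. Qed.

Lemma has_density_set0 (x : X) : has_density mu set0 x 0.
Proof.
apply: cvg_near_cst; apply: nearW => r.
by rewrite /density_ratio setI0 outer_measure0 mul0e.
Qed.

Lemma has_density_setT (x : X) : has_density mu setT x 1.
Proof.
apply: cvg_near_cst; near=> r.
have r0 : (0 < r)%R by near: r; exact: nbhs_right_gt.
by rewrite /density_ratio setIT divee ?ball_measure_fin_num ?gt_eqF
  ?ball_measure_gt0.
Unshelve. all: by end_near. Qed.

Lemma has_density_unique (A : set X) (x : X) (a b : \bar R) :
  has_density mu A x a -> has_density mu A x b -> a = b.
Proof. exact: (cvg_unique (@ereal_hausdorff R)). Qed.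

(** By measurability, [A] and its complement split the measure of each ball, so their density ratios
    add up to [1] at every positive radius. *)
Lemma has_densityC (A : set X) (x : X) : mu.-caratheodory A ->
  has_density mu (~` A) x 0 <-> has_density mu A x 1.
Proof.
move=> mA.
have ratioD : \forall r \near 0^'+,
    density_ratio mu A x r + density_ratio mu (~` A) x r = 1.
  near=> r; have r0 : (0 < r)%R by near: r; exact: nbhs_right_gt.
  rewrite /density_ratio -ge0_muleDl ?outer_measure_ge0//.
  rewrite -[X in X / _](mA (ball x r)).
  by rewrite divee ?ball_measure_fin_num ?gt_eqF ?ball_measure_gt0.
(* Ratios are at most [1], hence finite, which allows cancellation in [\bar R]. *)
have ratio_fin B : \forall r \near 0^'+, density_ratio mu B x r \is a fin_num.
  near=> r; have r0 : (0 < r)%R by near: r; exact: nbhs_right_gt.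
  rewrite ge0_fin_numE ?density_ratio_ge0//.
  apply: (@le_lt_trans _ _ 1); last exact: ltry.
  rewrite -(@divee _ (mu (ball x r))) ?ball_measure_fin_num ?gt_eqF
    ?ball_measure_gt0//.
  by rewrite lee_wpmul2r ?inve_ge0 ?outer_measure_ge0// le_outer_measure.
split=> dens.
- rewrite /has_density -[1 in X in _ --> X]sube0.
  apply: cvg_trans (cvgeB _ (cvg_cst 1) dens) => //.
  apply: near_eq_cvg; near=> r => /=.
  rewrite -(near ratioD r) ?addeK//; near: r; exact: ratio_fin.
- rewrite /has_density -[0 in X in _ --> X](@subee _ 1)//.
  apply: cvg_trans (cvgeB _ (cvg_cst 1) dens) => //.
  apply: near_eq_cvg; near=> r => /=.
  rewrite -(near ratioD r)// addeAC subee ?add0e//; near: r; exact: ratio_fin.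
Unshelve. all: by end_near. Qed.

Lemma has_density0S (A B : set X) (x : X) : A `<=` B ->
  has_density mu B x 0 -> has_density mu A x 0.
Proof.
move=> AB; apply: squeeze_cvge (cvg_cst 0).
near=> r; rewrite density_ratio_ge0/= lee_wpmul2r ?inve_ge0
  ?outer_measure_ge0// le_outer_measure//.
exact: setIS.
Unshelve. all: by end_near. Qed.

(** Positive upper density of a set means that it does not have density [0], which by measurability
    means that its complement does not have density [1]. *)
Lemma mt_boundaryE (E : set X) : mu.-caratheodory E ->
  mt_boundary mu E = ~` (mt_interior mu E `|` mt_interior mu (~` E)).
Proof.
move=> mE; have mEC := caratheodory_measurable_setC mE.
have cE x := has_densityC x mE; have := has_densityC _ mEC; rewrite setCK => cEC.
apply/seteqP; split=> x.
- move=> [/upper_density_gt0P E0 /upper_density_gt0P EC0] [/cE//|/cEC//].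
- move=> /not_orP[nI nIC]; split; apply/upper_density_gt0P.
  + by move=> /cEC.
  + by move=> /cE.
Qed.

Lemma mt_interior_disj (E : set X) (x : X) : mu.-caratheodory E ->
  mt_interior mu E x -> ~ mt_interior mu (~` E) x.
Proof.
move=> mE /(has_densityC x mE) EC0 /(has_density_unique EC0)/eqP.
by rewrite eq_sym onee_eq0.
Qed.

(** The set where the characteristic function is below [t] is empty for [t <= 0], the complement of
    [E] for [0 < t <= 1], and all of [X] for [t > 1]. So [t = 0] is always admissible, [t = 1]
    exactly on the measure theoretic interior, and larger [t] never. *)
Lemma approx_lower_charfun (E : set X) : mu.-caratheodory E ->
  approx_lower mu (charfun E) = charfun (mt_interior mu E).
Proof.
move=> mE; apply/funext => x; rewrite /charfun /=.
apply/eqP; rewrite eq_le; apply/andP; split.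
- apply: ge_ereal_sup => t /= dt; rewrite leNgt; apply/negP.
  rewrite indicE; case: (boolP (x \in _)) => [|/negP]; rewrite ?inE => xI t_gt.
    have := has_density_unique dt; move: (has_density_setT x).
    rewrite (_ : [set y | _] = setT).
      by move=> h /(_ _ h)/eqP; rewrite eq_sym onee_eq0.
    apply/seteqP; split=> y //= _; apply: le_lt_trans t_gt.
    by rewrite lee_fin indicE; case: (y \in E).
  apply: xI; apply/(has_densityC x mE); apply: has_density0S dt => y /= Ey.
  by rewrite indicE memNset.
- apply: ereal_sup_ubound => /=; rewrite (indicE _ _ x).
  case: (boolP (x \in _)) => [|_].
    rewrite inE => /(has_densityC x mE); apply: has_density0S => y /=.
    by rewrite indicE; case: (boolP (y \in E)) => [|/negP]; rewrite ?ltxx// inE.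
  have := has_density_set0 x; apply: has_density0S => y /=.
  by rewrite lte_fin indicE; case: (y \in E); rewrite ?ltxx// ltr10.
Qed.

(** Dually, the set where the characteristic function exceeds [t] is all of [X] for [t < 0], [E] for
    [0 <= t < 1], and empty for [t >= 1]. *)
Lemma approx_upper_charfun (E : set X) : mu.-caratheodory E ->
  approx_upper mu (charfun E) = charfun (~` mt_interior mu (~` E)).
Proof.
move=> mE; apply/funext => x; rewrite /charfun /=.
have := has_densityC x (caratheodory_measurable_setC mE); rewrite setCK => cEC.
apply/eqP; rewrite eq_le; apply/andP; split.
- apply: ereal_inf_lbound => /=; rewrite (indicE _ _ x) in_setC.
  case: (boolP (x \in _)) => [|_].
    rewrite inE => /cEC; apply: has_density0S => y /=.
    by rewrite indicE; case: (boolP (y \in E)); rewrite ?ltxx// inE.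
  have := has_density_set0 x; apply: has_density0S => y /=.
  by rewrite lte_fin indicE; case: (y \in E); rewrite ?ltxx// ltr10.
- apply: le_ereal_inf_tmp => t /= dt; rewrite leNgt; apply/negP.
  rewrite indicE in_setC; case: (boolP (x \in _)) => [|/negP].
    move=> _ t_lt; have := has_density_unique dt.
    move: (has_density_setT x); rewrite (_ : [set y | _] = setT).
      by move=> h /(_ _ h)/eqP; rewrite eq_sym onee_eq0.
    apply/seteqP; split=> y //= _; apply: lt_le_trans t_lt _.
    by rewrite lee_fin indicE; case: (y \in E).
  rewrite inE => xI t_lt; apply: xI; apply/cEC.
  by apply: has_density0S dt => y /= Ey; rewrite indicE mem_set.
Qed.

End density.

(** * Jump values where the approximate limits agree *)

Section jump_values.
Context {R : realType} {X : completeMetricType R}.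
Variable mu : {outer_measure set X -> \bar R}.

(** By induction every earlier value already equals the upper limit, so the strict inequality
    guarding the supremum fails at each step. *)
Lemma jump_value_const (n l : nat) (v : X -> \bar R) (x : X) :
  approx_lower mu v x = approx_upper mu v x ->
  jump_value mu n v l x = approx_upper mu v x.
Proof.
move=> lu; rewrite /jump_value; case: ifPn => // _.
by elim: l => [//|[|l] IH] //=; rewrite [X in X < _]IH ltxx.
Qed.

(** All jump values at [x] equal [w x], so the minimum bounds the distance from [w (y k)] to [w x].
    Once it is below [1], two values in [{0, 1}] must coincide. *)
Lemma min_jump_cvg_near (n : nat) (A : set X) (v w : X -> \bar R) (x : X) :
  approx_lower mu v x = approx_upper mu v x ->
  (forall y, w y = 0 \/ w y = 1) ->
  approx_upper mu v x = w x ->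
  (forall y : nat -> X, (forall k, A (y k)) -> y @ \oo --> x ->
     \big[Order.min/+oo]_(1 <= l < n.+1)
         `|w (y k) - jump_value mu n v l x| @[k --> \oo] --> 0) ->
  \forall y \near x, A y -> w y = w x.
Proof.
move=> lu w01 ux mincvg; apply: near_within_sequential => y yA yx.
have /fine_cvgP[fin /cvgr0Pnorm_lt/(_ 1%R ltr01)lt1] := mincvg y yA yx.
near=> k.
have : `|w (y k) - w x| < 1.
  apply: (@le_lt_trans _ _
      (\big[Order.min/+oo]_(1 <= l < n.+1) `|w (y k) - jump_value mu n v l x|)).
    (* The default value [+oo] of the minimum satisfies the lower bound trivially. *)
    by apply: le_bigmin => [|l _]; rewrite ?leey// jump_value_const// ux.
  rewrite -[X in X < _]fineK; last by near: k.
  by rewrite lte_fin; apply: le_lt_trans (ler_norm _) _; near: k.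
have [-> | ->] := w01 (y k); have [-> | ->] := w01 x => //.
- by rewrite sub0e abseN abse1 ltxx.
- by rewrite sube0 abse1 ltxx.
Unshelve. all: by end_near. Qed.
End jump_values.

Theorem proposition6p2 (R : realType) (X : completeMetricType R)
    (mu : {outer_measure set X -> \bar R}) (Cd CP lambda gamma : R)
    (mu_regular : borel_regular mu)
    (Cd_ge1 : (1 <= Cd)%R) (mu_doubling : doubling mu Cd)
    (CP_gt0 : (0 < CP)%R) (lambda_ge1 : (1 <= lambda)%R)
    (mu_poincare : poincare mu CP lambda)
    (gamma_gt0 : (0 < gamma)%R) (gamma_le : (gamma <= 1 / 2)%R)
    (gamma_bound : perimeter_density_bound mu gamma)
    (E G : set X) (eps : R) (n := Num.truncn gamma^-1)
    (u := charfun E) :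
  finite_perimeter mu E ->
  (0 < eps)%R -> open G -> Cap1 mu G < eps%:E ->
  (forall (y : nat -> X) (x : X), (forall k, (~` G) (y k)) -> (~` G) x ->
     y @ \oo --> x ->
     forall l1 : nat, (1 <= l1 <= n)%N ->
       \big[Order.min/+oo]_(1 <= l2 < n.+1)
         `|jump_value mu n u l1 (y k) - jump_value mu n u l2 x|
         @[k --> \oo] --> 0) ->
  [/\ relative_boundary (~` G) (mt_interior mu E) `<=` mt_boundary mu E `\` G,
      closed (relative_boundary (~` G) (mt_interior mu E)) &
      closed (mt_boundary mu E `\` G)].
Proof.
set A := ~` G.
move=> [mE _] _ oG _ mincvg.
have clA : closed A by exact: open_closedC.
have mEC := caratheodory_measurable_setC mE.
set I := mt_interior mu E; set O := mt_interior mu (~` E).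
have lowerE : approx_lower mu u = charfun I.
  exact: approx_lower_charfun Cd_ge1 mu_doubling _ mE.
have upperE : approx_upper mu u = charfun (~` O).
  exact: approx_upper_charfun Cd_ge1 mu_doubling _ mE.
have bdryE : mt_boundary mu E = ~` (I `|` O).
  exact: mt_boundaryE Cd_ge1 mu_doubling _ mE.
have IO x : I x -> ~ O x := mt_interior_disj Cd_ge1 mu_doubling mE.
(* This follows from [gamma <= 1/2]. It separates the indices [1] and [n], so that [jump_value] at
   [1] is the lower limit and not the prescribed upper one. *)
have n_ge2 : (2 <= n)%N.
  rewrite truncn_ge_nat ?invr_ge0 ?(ltW gamma_gt0)//.
  by rewrite -[2%:R]invrK lef_pV2 ?posrE// -[X in (_ <= X)%R]div1r.
have jump1 : jump_value mu n u 1 = charfun I.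
  by apply/funext => y; rewrite /jump_value /= lowerE ltn_eqF.
have jumpn : jump_value mu n u n = charfun (~` O).
  by apply/funext => y; rewrite /jump_value eqxx upperE.
(* Used with [B = I], [l = 1] and with [B = ~] O[,]l = n[. The condition]I x <-> (~[O) x] says that
   the lower and upper limits agree at [x]. *)
have near_const B l x : (1 <= l <= n)%N -> jump_value mu n u l = charfun B ->
    A x -> (I x <-> (~` O) x) -> ((~` O) x <-> B x) ->
    \forall y \near x, A y -> (B y <-> B x).
  move=> ln jumpB Ax IOx OBx.
  have : \forall y \near x, A y -> charfun B y = charfun B x :> \bar R.
    apply: (@min_jump_cvg_near _ _ mu n A u); rewrite ?lowerE ?upperE.
    - exact/charfun_eqP.
    - by move=> y; rewrite /charfun /= indicE; case: (y \in B); [right|left].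
    - exact/charfun_eqP.
    - by move=> y yA yx; rewrite -jumpB; exact: mincvg.
  by apply: filterS => y + Ay => /(_ Ay)/charfun_eqP.
have nearI x : A x -> I x -> \forall y \near x, A y -> I y.
  move=> Ax Ix; have nOx : (~` O) x by exact: IO.
  have : \forall y \near x, A y -> (I y <-> I x).
    by apply: near_const jump1 Ax _ _; rewrite ?(ltnW n_ge2).
  by apply: filterS => y + Ay => /(_ Ay)[_]; exact.
have nearO x : A x -> O x -> \forall y \near x, A y -> O y.
  move=> Ax Ox; have nnOx : ~ (~` O) x by move=> /(_ Ox).
  have nIx : ~ I x by move=> /IO.
  have : \forall y \near x, A y -> ((~` O) y <-> (~` O) x).
    by apply: near_const jumpn Ax _ _; rewrite ?leqnn ?(ltnW n_ge2).
  by apply: filterS => y + Ay => /(_ Ay)[nOO _]; apply: contrapT => /nOO.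
split.
- move=> x [+ nint]; rewrite closure_subspaceW; last by move=> y [].
  move=> [clx Ax]; split=> //; rewrite bdryE => -[Ix|Ox].
  (* Relative openness of [I] would put [x] in the relative interior. *)
  + apply: nint; rewrite /interior /=; case: (nbhs_subspaceP A x) => // _.
    by apply: filterS (nearI _ Ax Ix) => y yI Ay; split => //; exact: yI.
  (* Near [x] the points of [A] lie in [O], yet [x] is a limit of points of [I] in [A]; this
     contradicts disjointness. *)
  + have [y [[Iy Ay] yO]] := clx _ (nearO _ Ax Ox).
    by apply: (IO _ Iy); exact: yO.
- exact: closed_relative_boundary.
- move=> x clx; have Ax : A x.
    by apply: clA => B /clx[y [[_ Ay] By]]; exists y.
  (* A limit point lying in [I] or [O] would have a neighbourhood whose trace on [A] stays in that
     set, although it meets the boundary. *)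
  split=> //; rewrite bdryE => -[/(nearI _ Ax)|/(nearO _ Ax)] /clx[y [[+ Ay]]];
    rewrite bdryE => nIO /(_ Ay) ?; apply: nIO; by [left|right].
Qed.
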